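(* Let $n>1$. For all $\epsilon$ with $2^{-n\log n}\le\epsilon\le\tfrac13$, the $\epsilon$-approximate degree of $BPM_n$ satisfies $\widetilde{\deg}_\epsilon(BPM_n)=\mathcal{O}(n^{1.5}\sqrt{\log n})$ (with the implied constant independent of $n$ and $\epsilon$).
   Context: $BPM_n:\{0,1\}^{n^2}\to\{0,1\}$ outputs 1 iff the bipartite graph $\{(a_i,b_j):x_{i,j}=1\}\subseteq K_{n,n}$ has a perfect matching. The $\epsilon$-approximate degree $\widetilde{\deg}_\epsilon(f)$ of a Boolean function $f$ is the least degree of a real polynomial $p$ with $|f(x)-p(x)|\le\epsilon$ for all Boolean inputs $x$. *)

(* Defs.v *)
From mathcomp Require Import all_boot all_order all_algebra.
(* The notations of mpoly clash with those of MathComp-Analysis. *)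
From mathcomp Require Import -(notations) mpoly.
From mathcomp Require Import boolp reals exp.

Set Implicit Arguments.
Unset Strict Implicit.
Unset Printing Implicit Defensive.

Import Order.TTheory GRing.Theory Num.Theory.
Local Open Scope ring_scope.

Section ApproximateDegree.
Variables (R : realType) (m : nat).
Implicit Types (f : {ffun 'I_m -> bool} -> bool) (eps : R) (p : mpoly.mpoly m R).

(* msize is the total degree plus one, and is 0 at the zero polynomial, so the
   zero polynomial gets degree 0 here. *)
Definition total_degree p : nat := (mpoly.msize p).-1.

Definition approximates f eps p : Prop :=
  forall x : {ffun 'I_m -> bool},
    `|(f x)%:R - mpoly.meval (fun i => (x i)%:R) p| <= eps.

Definition approx_at_degree f eps (d : nat) : Prop :=
  exists2 p, total_degree p = d & approximates f eps p.

(* The value 0 in the second branch only occurs when no polynomial approximates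
   f, which approx_degreeP rules out for 0 <= eps. *)
Definition approx_degree f eps : nat :=
  if pselect (exists d, `[< approx_at_degree f eps d >]) is left ex_d
  then ex_minn ex_d else 0%N.

Lemma exact_polynomial f : exists p, approximates f 0 p.
Proof.
pose X i : mpoly.mpoly m R := mpoly.mpolyX R (mpoly.mnm1 i).
pose lit (b : bool) i := if b then X i else 1 - X i.
exists (\sum_(a : {ffun 'I_m -> bool} | f a) \prod_i lit (a i) i) => x.
set v := fun i => _.
have litE b i : mpoly.meval v (lit b i) = (x i == b)%:R.
  rewrite /lit /X; case: b.
    by rewrite mpoly.mevalXU /v; case: (x i).
  by rewrite mpoly.mevalB mpoly.meval1 mpoly.mevalXU /v; case: (x i);
    rewrite ?subrr ?subr0.
have prodE (a : {ffun 'I_m -> bool}) :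
    mpoly.meval v (\prod_i lit (a i) i) = (x == a)%:R.
  rewrite rmorph_prod /=; have [<-|xa] := eqVneq x a.
    by rewrite big1 // => i _; rewrite litE eqxx.
  have [i xai] : exists i, x i != a i.
    apply/existsP; apply: contraR xa; rewrite negb_exists => /forallP xa.
    by apply/eqP/ffunP => i; apply/eqP; have := xa i; rewrite negbK.
  by rewrite (bigD1 i) //= litE (negbTE xai) mul0r.
rewrite rmorph_sum /= (eq_bigr _ (fun a _ => prodE a)).
have [fx|fx] := boolP (f x).
  rewrite (bigD1 x) //= eqxx big1 ?addr0 ?subrr ?normr0 //.
  by move=> a /andP[_ /negbTE ax]; rewrite eq_sym ax.
rewrite big1 ?subrr ?normr0 // => a fa.
by have [xa|//] := eqVneq x a; rewrite xa fa in fx.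
Qed.

Lemma approx_degreeP f eps : 0 <= eps ->
  approx_at_degree f eps (approx_degree f eps) /\
  (forall p, approximates f eps p ->
    (approx_degree f eps <= total_degree p)%N).
Proof.
move=> eps0; rewrite /approx_degree; case: pselect => [ex_d|[]].
  case: ex_minnP => d /asboolP fd dmin; split=> // p fp.
  by apply: dmin; apply/asboolP; exists p.
have [p fp] := exact_polynomial f.
exists (total_degree p); apply/asboolP; exists p => // x.
exact: le_trans (fp x) eps0.
Qed.

End ApproximateDegree.

Section BipartitePerfectMatching.
Variable n : nat.

(* The edge (i, j) of K_{n,n} joins the left vertex a_i to the right vertex
   b_j. *)
Definition perfect_matching (E M : {set 'I_n * 'I_n}) : bool :=
  [&& M \subset E,
      [forall i, #|[set e in M | e.1 == i]| == 1%N] &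
      [forall j, #|[set e in M | e.2 == j]| == 1%N]].

(* mxvec_index i j is the position of the variable x_{i,j} among the n ^ 2
   variables. *)
Definition graph_of_input (x : {ffun 'I_(n * n) -> bool}) :
    {set 'I_n * 'I_n} :=
  [set e | x (mxvec_index e.1 e.2)].

Definition BPM (x : {ffun 'I_(n * n) -> bool}) : bool :=
  [exists M, perfect_matching (graph_of_input x) M].

End BipartitePerfectMatching.

Definition log2 (R : realType) (x : R) : R := ln x / ln 2.

(* Main.v *)
Require Import Defs.
From mathcomp Require Import all_boot all_order all_algebra.
From mathcomp Require Import -(notations) mpoly.
From mathcomp Require Import reals exp.
From mathcomp Require Import ring lra zify.
Import Order.TTheory GRing.Theory Num.Theory.
Local Open Scope ring_scope.

(** By Hall's theorem, BPM(x) = 1 iff no set U of vertices with fewer right than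
    left vertices is closed under the edges of x. If A and B are two such sets,
    then so is A cap B or A cup B, and this forces the order complex of the
    family of such sets to be a cone up to homotopy as soon as it is nonempty.
    Computing its Euler characteristic writes BPM(x) as a signed sum, over the
    n^O(n) chains of deficient sets, of the conjunctions "no edge of x leaves a
    member of the chain".

    A conjunction over at most N = n^2 variables is approximated within 2^-t by
    a polynomial p of degree O(sqrt(N t)) in the number of falsified literals:
    p is the product over i = 1, ..., t of rescaled Chebyshev polynomials of
    degree O(sqrt(N / i)) that equal 1 at 0, vanish at i, are at most 1 in
    absolute value on [0, N], and at most 1/2 on [i, N]. Taking t = O(n log n)
    absorbs both the number of chains and 1 / eps. *)

(** * Approximating a conjunction *)

(* The values at y of the Chebyshev polynomials T_k and U_(k-1). *)
Fixpoint chebyshev_pair {R : pzRingType} (y : R) (k : nat) : R * R :=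
  if k is k'.+1 then
    let: (a, b) := chebyshev_pair y k' in
    (y * a + (y ^+ 2 - 1) * b, a + y * b)
  else (1, 0).

Notation cheb1 y k := (chebyshev_pair y k).1.
Notation cheb2 y k := (chebyshev_pair y k).2.

Lemma cheb1S (R : pzRingType) (y : R) k :
  cheb1 y k.+1 = y * cheb1 y k + (y ^+ 2 - 1) * cheb2 y k.
Proof. by rewrite /=; case: chebyshev_pair. Qed.

Lemma cheb2S (R : pzRingType) (y : R) k :
  cheb2 y k.+1 = cheb1 y k + y * cheb2 y k.
Proof. by rewrite /=; case: chebyshev_pair. Qed.

(** [cheb1 y k + cheb2 y k * sqrt (y^2 - 1)] is the [k]-th power of [y + sqrt (y^2 - 1)], which has
    norm 1. This Pell identity takes the place of cosines. *)
Lemma chebyshev_pell (R : comPzRingType) (y : R) k :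
  cheb1 y k ^+ 2 = 1 + (y ^+ 2 - 1) * cheb2 y k ^+ 2.
Proof.
elim: k => [|k IHk]; first by rewrite /= !expr2; ring.
rewrite cheb1S cheb2S; set a := cheb1 y k in IHk *; set b := cheb2 y k in IHk *.
transitivity (a ^+ 2 - (y ^+ 2 - 1) * b ^+ 2 + (y ^+ 2 - 1) * (a + y * b) ^+ 2).
  by ring.
by rewrite IHk; ring.
Qed.

Lemma chebyshev_norm_le1 (R : realDomainType) (y : R) k :
  `|y| <= 1 -> `|cheb1 y k| <= 1.
Proof.
move=> y1; rewrite -(@expr_le1 _ 2) // -normrX ger0_norm ?sqr_ge0 //.
rewrite chebyshev_pell gerDl mulr_le0_ge0 ?sqr_ge0 // subr_le0.
by rewrite -real_normK ?num_real // expr_le1.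
Qed.

Lemma chebyshev_mono (R : realDomainType) (y z : R) k : 1 <= y -> y <= z ->
  0 <= cheb1 y k <= cheb1 z k /\ 0 <= cheb2 y k <= cheb2 z k.
Proof.
move=> y1 yz; elim: k => [|k [IHa IHb]]; first by rewrite /= ler01 !lexx.
rewrite !cheb1S !cheb2S.
have dy : 0 <= y ^+ 2 - 1 by nra.
have dz : y ^+ 2 - 1 <= z ^+ 2 - 1 by nra.
by split; nra.
Qed.

(** The derivative of T_k at 1 is k^2, so this is the tangent bound there. The bound on [cheb2]
    carries the induction. *)
Lemma chebyshev_growth (R : realDomainType) (s : R) k : 0 <= s ->
  1 + k%:R ^+ 2 * s <= cheb1 (1 + s) k /\ k%:R <= cheb2 (1 + s) k.
Proof.
move=> s0; elim: k => [|k [IHa IHb]]; first by rewrite /= expr0n mul0r addr0.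
rewrite cheb1S cheb2S -natr1.
have k0 : 0 <= k%:R :> R by [].
set a := cheb1 _ k in IHa *; set b := cheb2 _ k in IHb *; set K := k%:R in k0 IHa IHb *.
have a1 : 1 <= a by nra.
split; last by nra.
have -> : (1 + s) ^+ 2 - 1 = 2 * s + s ^+ 2 by ring.
have : 0 <= s ^+ 2 by rewrite sqr_ge0.
by nra.
Qed.

Lemma size_chebyshev (R : nzRingType) (y : {poly R}) k : (size y <= 2)%N ->
  (size (cheb1 y k) <= k.+1)%N /\ (size (cheb2 y k) <= k)%N.
Proof.
move=> y2; elim: k => [|k [IHa IHb]]; first by rewrite /= size_poly1 size_poly0.
rewrite cheb1S cheb2S.
have yM (p : {poly R}) : (size (y * p)%R <= (size p).+1)%N.
  by apply: (leq_trans (size_polyMleq _ _)); lia.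
have ddM (p : {poly R}) : (size ((y ^+ 2 - 1) * p)%R <= (size p).+2)%N.
  have : (size (y ^+ 2 - 1)%R <= 3)%N.
    apply: (leq_trans (size_polyD _ _)); rewrite size_polyN size_poly1 geq_max.
    by rewrite expr2 (leq_trans (yM _)).
  by have := size_polyMleq (y ^+ 2 - 1) p; lia.
split; apply: (leq_trans (size_polyD _ _)); rewrite geq_max.
  by rewrite (leq_trans (yM _)) //= (leq_trans (ddM _)).
by rewrite IHa (leq_trans (yM _)).
Qed.

Lemma horner_chebyshev (R : comNzRingType) (y : {poly R}) (a : R) k :
  (cheb1 y k).[a] = cheb1 y.[a] k /\ (cheb2 y k).[a] = cheb2 y.[a] k.
Proof.
elim: k => [|k [IHa IHb]]; first by rewrite /= !hornerE.
by rewrite !cheb1S !cheb2S !hornerE IHa IHb.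
Qed.

(* With T = T_m, the witness is (T(1 + 2(i - a)/N) - 1) / (T(1 + 2i/N) - 1): its
   numerator is in [-2, 0] for i <= a <= N, while m^2 i >= 2N makes the
   denominator at least 4. *)
Lemma exists_zero_factor (R : realFieldType) (N i m : nat) :
  (0 < i <= N)%N -> (2 * N <= m ^ 2 * i)%N ->
  exists q : {poly R}, [/\ (size q <= m.+1)%N, q.[0] = 1, q.[i%:R] = 0,
    forall j, (j <= N)%N -> `|q.[j%:R]| <= 1 &
    forall j, (i <= j <= N)%N -> `|q.[j%:R]| <= 2^-1].
Proof.
move=> /andP[i0 iN] mi.
have N0 : 0 < N%:R :> R by rewrite ltr0n; lia.
pose c : R := 2 / N%:R.
have c0 : 0 < c by rewrite divr_gt0.
have cN : c * N%:R = 2 by rewrite mulfVK // gt_eqF.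
(* This affine map sends [i] to 1, the interval from [i] to [N] into [-1, 1], and points left of [i]
   beyond 1. *)
pose y : {poly R} := (1 + c * i%:R)%:P - c *: 'X.
have yE a : y.[a] = 1 + c * (i%:R - a) by rewrite !hornerE; ring.
have ysz : (size y <= 2)%N.
  apply: (leq_trans (size_polyD _ _)); rewrite size_polyN geq_max.
  rewrite (leq_trans (size_polyC_leq1 _)) //=.
  by rewrite (leq_trans (size_scale_leq _ _)) // size_polyX.
pose T (x : R) := cheb1 x m.
have T1 : T 1 = 1.
  rewrite /T; elim: (m) => [//|k IHk].
  by rewrite cheb1S IHk expr1n subrr mul0r addr0 mulr1.
have growth : 5 <= T y.[0].
  have ci0 : 0 <= c * i%:R by rewrite mulr_ge0 // ltW.
  rewrite yE subr0; have [+ _] := chebyshev_growth R _ m ci0.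
  apply: le_trans.
  have : (2 * N)%:R <= (m ^ 2 * i)%:R :> R by rewrite ler_nat.
  by rewrite natrM [(m ^ 2 * i)%:R]natrM natrX; nra.
have Tm : 4 <= T y.[0] - 1 by lra.
have Tm0 : 0 < T y.[0] - 1 by lra.
pose P : {poly R} := cheb1 y m.
have PE a : P.[a] = T y.[a] := (horner_chebyshev R y a m).1.
pose q : {poly R} := (T y.[0] - 1)^-1 *: (P - 1).
have qE a : q.[a] = (T y.[a] - 1) / (T y.[0] - 1).
  by rewrite hornerZ hornerD PE !hornerE mulrC.
have small j : (i <= j <= N)%N -> `|q.[j%:R]| <= 2^-1.
  move=> /andP[ij jN]; rewrite qE normrM normfV (gtr0_norm Tm0) ler_pdivrMr //.
  suff : `|T y.[j%:R]| <= 1 by move=> /ler_normlP[? ?]; apply/ler_normlP; split; lra.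
  apply: chebyshev_norm_le1; rewrite yE.
  have ij' : i%:R <= j%:R :> R by rewrite ler_nat.
  have jN' : j%:R <= N%:R :> R by rewrite ler_nat.
  have i0' : 0 <= i%:R :> R by [].
  by apply/ler_normlP; split; nra.
exists q; split => //.
- apply: (leq_trans (size_scale_leq _ _)); apply: (leq_trans (size_polyD _ _)).
  by rewrite size_polyN size_poly1 geq_max andbT (size_chebyshev _ _ _ ysz).1.
- by rewrite qE divff // gt_eqF.
- by rewrite qE yE subrr mulr0 addr0 T1 subrr mul0r.
(* Left of [i], the argument of [T] lies between 1 and [y.[0]], where [T] increases, so the quotient
   stays in [0, 1]. *)
move=> j jN; case: (leqP i j) => ij.
  by apply: (le_trans (small j _)); rewrite ?ij //; lra.
have ij' : j%:R <= i%:R :> R by rewrite ler_nat ltnW.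
have j0 : 0 <= j%:R :> R by [].
have yj1 : 1 <= y.[j%:R] by rewrite yE; nra.
have [/andP[_ low] _] := @chebyshev_mono R 1 y.[j%:R] m (lexx _) yj1.
have [/andP[_ up] _] := @chebyshev_mono R y.[j%:R] y.[0] m yj1 ltac:(rewrite !yE; nra).
rewrite -!/(T _) T1 in low up.
rewrite qE normrM normfV (gtr0_norm Tm0) ler_pdivrMr // mul1r.
by apply/ler_normlP; split; lra.
Qed.

Lemma exists_zero_indicator (R : realFieldType) (N t : nat) (m : nat -> nat) :
  (forall i, (0 < i <= N)%N -> (2 * N <= m i ^ 2 * i)%N) ->
  exists p : {poly R},
    [/\ (size p <= (\sum_(1 <= i < (minn t N).+1) m i).+1)%N, p.[0] = 1 &
      forall j, (0 < j <= N)%N -> `|p.[j%:R]| <= 2^-1 ^+ t].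
Proof.
move=> mP.
(* With k factors, the induction keeps zeros at 1, ..., k and the bound 2^-k on [k, N]. Points
   beyond [minn t N] exist only if [t < N], and there the bound is 2^-t. *)
suff [p [sp p0 pz ps]] : exists p : {poly R},
    [/\ (size p <= (\sum_(1 <= i < (minn t N).+1) m i).+1)%N, p.[0] = 1,
      forall j, (0 < j <= minn t N)%N -> p.[j%:R] = 0 &
      forall j, (minn t N <= j <= N)%N -> `|p.[j%:R]| <= 2^-1 ^+ (minn t N)].
  exists p; split=> // j /andP[j0 jN].
  have [jt|tj] := leqP j (minn t N); first by rewrite pz ?j0 // normr0 exprn_ge0 ?invr_ge0.
  have tN : minn t N = t by lia.
  by rewrite -tN ps // jN ltnW.
have : (minn t N <= N)%N by rewrite geq_minr.
elim: (minn t N) => {t} [|t IHt] tN.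
  exists 1; split=> [|| j /andP[/leq_trans h /h //]|j _].
  - by rewrite size_poly1.
  - by rewrite hornerE.
  - by rewrite hornerE normr1 expr0.
have [p [sp p0 pz ps]] := IHt (ltnW tN).
have [q [sq q0 qz q1 qs]] := @exists_zero_factor R N t.+1 (m t.+1) tN (mP t.+1 tN).
exists (p * q); split.
- apply: (leq_trans (size_polyMleq _ _)).
  rewrite big_nat_recr //=.
  have aux a b c d : (a <= c.+1 -> b <= d.+1 -> (a + b).-1 <= (c + d).+1)%N by lia.
  exact: aux sp sq.
- by rewrite hornerM p0 q0 mulr1.
- move=> j /andP[j0]; rewrite hornerM leq_eqVlt => /predU1P[->|jt].
    by rewrite qz mulr0.
  by rewrite pz ?mul0r // j0.
move=> j /andP[tj jN]; rewrite hornerM normrM exprSr.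
by rewrite ler_pM // ?ps ?qs ?jN ?andbT // ltnW.
Qed.

Lemma sum_inv_sqrt_le (R : rcfType) (t : nat) :
  \sum_(1 <= i < t.+1) (Num.sqrt i%:R)^-1 <= 2 * Num.sqrt t%:R :> R.
Proof.
elim: t => [|t IHt]; first by rewrite big_nil mulr_ge0 ?sqrtr_ge0.
rewrite big_nat_recr //=.
set s := Num.sqrt t%:R in IHt *; set u := Num.sqrt t.+1%:R.
have u0 : 0 < u by rewrite sqrtr_gt0 ltr0n.
have s2 : s ^+ 2 = t%:R by rewrite sqr_sqrtr.
have u2 : u ^+ 2 = s ^+ 2 + 1 by rewrite s2 sqr_sqrtr // natr1.
apply: (le_trans (lerD IHt (lexx _))).
rewrite -(ler_pM2r u0) mulrDl mulVf ?gt_eqF //.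
(* As u^2 - s^2 = 1, the square yields 1/u <= 2(u - s), which telescopes. *)
by have := sqr_ge0 (u - s); nra.
Qed.

Lemma zero_indicator_degree (R : realType) (N t : nat) :
  exists p : {poly R},
    [/\ (size p).-1%:R <= 4 * Num.sqrt (N * t)%:R :> R, p.[0] = 1 &
      forall j, (0 < j <= N)%N -> `|p.[j%:R]| <= 2^-1 ^+ t].
Proof.
pose r i : R := Num.sqrt (2 * N%:R) / Num.sqrt i%:R.
have r0 i : 0 <= r i by rewrite divr_ge0 ?sqrtr_ge0.
have [|p [sp p0 ps]] := @exists_zero_indicator R N t (fun i => (Num.truncn (r i)).+1).
  move=> i /andP[i0 iN].
  rewrite -(@ler_nat R) natrM [(_ * i)%:R]natrM natrX.
  have i0' : 0 < i%:R :> R by rewrite ltr0n.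
  rewrite -ler_pdivrMr //.
  have -> : 2 * N%:R / i%:R = r i ^+ 2 by rewrite /r expr_div_n !sqr_sqrtr ?mulr_ge0.
  by rewrite lerXn2r ?nnegrE // ltW // truncnS_gt.
exists p; split=> //.
set k := minn t N in sp.
have kN : (k <= N)%N by rewrite geq_minr.
have kt : (k <= t)%N by rewrite geq_minl.
apply: (@le_trans _ _ (\sum_(1 <= i < k.+1) (Num.truncn (r i)).+1)%:R).
  have aux a b : (a <= b.+1 -> a.-1 <= b)%N by lia.
  by rewrite ler_nat; exact: aux sp.
rewrite natr_sum; apply: (@le_trans _ _ (\sum_(1 <= i < k.+1) (r i + 1))).
  by apply: ler_sum => i _; rewrite -natr1 lerD2r truncn_le.
rewrite big_split /= -mulr_sumr sumr_const_nat subSS subn0.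
have /(ler_wpM2l (sqrtr_ge0 (2 * N%:R : R))) h := sum_inv_sqrt_le R k.
apply: (le_trans (lerD h (lexx _))).
have a0 : 0 <= N%:R :> R by [].
have b0 : 0 <= k%:R :> R by [].
set a := Num.sqrt (N * t)%:R.
have ka : k%:R <= a.
  rewrite -(ler_pXn2r (ltn0Sn 1)) ?nnegrE ?sqrtr_ge0 // sqr_sqrtr //.
  by rewrite -natrX ler_nat; nia.
(* Here 3/2 bounds sqrt 2; the total is then 2 * 3/2 + 1 = 4 times [a]. *)
have ha : Num.sqrt (2 * N%:R) * Num.sqrt k%:R <= 3/2 * a.
  rewrite -(ler_pXn2r (ltn0Sn 1)) ?nnegrE ?mulr_ge0 ?sqrtr_ge0 //; last lra.
  rewrite !exprMn !sqr_sqrtr ?mulr_ge0 //.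
  have : (N * k)%:R <= (N * t)%:R :> R by rewrite ler_nat; nia.
  have : 0 <= (N * t)%:R :> R by [].
  by rewrite natrM; lra.
by lra.
Qed.

(** * Chains in a family of sets *)

(** The empty family counts as a chain, so alternating sums over chains are reduced Euler
    characteristics up to sign. *)
Definition chain {T : finType} (C : {set {set T}}) : bool :=
  [forall A in C, forall B in C, (A \subset B) || (B \subset A)].

Lemma chainP (T : finType) (C : {set {set T}}) :
  reflect {in C &, forall A B : {set T}, (A \subset B) || (B \subset A)} (chain C).
Proof.
apply: (iffP forall_inP) => [h A B AC BC | h A AC].
  by have /forall_inP := h A AC; apply.
by apply/forall_inP => B; apply: h.
Qed.

Lemma chain_card_le (T : finType) (C : {set {set T}}) (A B : {set T}) :
  chain C -> A \in C -> B \in C -> (#|A| <= #|B|)%N -> A \subset B.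
Proof.
move=> /chainP cC AC BC AB; have /orP[//|BA] := cC A B AC BC.
by have /eqP -> : B == A by rewrite eqEcard BA.
Qed.

Lemma bigcup_chain (T : finType) (C : {set {set T}}) :
  chain C -> C != set0 -> \bigcup_(A in C) A \in C.
Proof.
move=> cC /set0Pn[A0 A0C].
have [A AC Amax] := @arg_maxnP _ A0 (mem C) (fun A => #|A|) A0C.
suff -> : \bigcup_(B in C) B = A by [].
apply/eqP; rewrite eqEsubset bigcup_sup // andbT.
by apply/bigcupsP => B BC; apply: (chain_card_le _ _ _ _ cC) => //; apply: Amax.
Qed.

(* If m has least cardinality in F, then F is closed under joining with m. Adding
   or removing the join of m with the largest member of C not containing m is
   then a sign-reversing involution on the chains C of F. *)
Lemma sum_sign_chains (T : finType) (R : numDomainType) (F : {set {set T}}) :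
  {in F &, forall A B : {set T}, (A :&: B \in F) || (A :|: B \in F)} ->
  \sum_(C : {set {set T}} | chain C && (C \subset F)) (-1) ^+ #|C|
    = (F == set0)%:R :> R.
Proof.
move=> FP; have [->|] := eqVneq F set0.
  rewrite (bigD1 set0) /=; last first.
    by rewrite sub0set andbT; apply/chainP => A B; rewrite inE.
  rewrite cards0 expr0 big1 ?addr0 // => C /andP[/andP[_ /[!subset0] /eqP->]].
  by rewrite eqxx.
case/set0Pn=> m0 m0F.
have [m mF mmin] := @arg_minnP _ m0 (mem F) (fun A => #|A|) m0F.
(* If [m :&: X] is in [F], minimality makes it equal to [m], and the join is [X] itself. *)
have mU X : X \in F -> m :|: X \in F.
  move=> XF; have /orP[mX|//] := FP m X mF XF.
  suff /setUidPr-> : m \subset X by [].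
  apply/setIidPl/eqP; rewrite eqEcard subsetIl /=; exact: mmin.
pose below (C : {set {set T}}) := [set A in C | ~~ (m \subset A)].
pose top C := m :|: \bigcup_(A in below C) A.
pose toggle C := if top C \in C then C :\ top C else top C |: C.
have m_top C : m \subset top C by rewrite subsetUl.
(* The toggled set contains [m], so toggling changes neither [below] nor [top]. *)
have belowE C : below (toggle C) = below C.
  apply/setP => A; rewrite !inE /toggle; case: ifP => tC; rewrite !inE.
    by have [->|//] := eqVneq A (top C); rewrite m_top /= andbF.
  by have [->|//] := eqVneq A (top C); rewrite m_top /= andbF.
have topE C : top (toggle C) = top C by rewrite /top belowE.
have toggleK : involutive toggle.
  move=> C; rewrite {1}/toggle topE /toggle.
  case tC: (top C \in C); first by rewrite !inE eqxx /= setD1K.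
  by rewrite !inE eqxx /= setU1K ?tC.
have toggleP C : chain C && (C \subset F) -> chain (toggle C) && (toggle C \subset F).
  move=> /andP[cC CF]; have /chainP cC' := cC.
  have tF : top C \in F.
    rewrite /top; have [->|b0] := eqVneq (below C) set0.
      by rewrite big_set0 setU0.
    apply: mU; apply: (subsetP CF); have : below C \subset C.
      by apply/subsetP => A; rewrite inE => /andP[].
    move/subsetP; apply; apply: bigcup_chain => //.
    by apply/chainP => A B /[!inE] /andP[AC _] /andP[BC _]; apply: cC'.
  (* A member containing [m] contains every member that does not, hence also [top C]; the other
     members lie below [top C]. *)
  have tcomp B : B \in C -> (top C \subset B) || (B \subset top C).
    move=> BC; have [mB|mB] := boolP (m \subset B); last first.
      apply/orP; right; rewrite /top (subset_trans _ (subsetUr _ _)) //.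
      by apply: (bigcup_sup B) => //; rewrite inE BC.
    apply/orP; left; rewrite subUset mB /=; apply/bigcupsP => A.
    rewrite inE => /andP[AC mA]; have /orP[//|BA] := cC' A B AC BC.
    by rewrite (subset_trans mB BA) in mA.
  rewrite /toggle; case: ifP => tC; apply/andP; split.
  - by apply/chainP => A B /[!inE] /andP[_ AC] /andP[_ BC]; apply: cC'.
  - by rewrite (subset_trans (subsetDl _ _)).
  - apply/chainP => A B /setU1P[->|AC] /setU1P[->|BC].
    + by rewrite subxx.
    + exact: tcomp.
    + by rewrite orbC tcomp.
    + exact: cC'.
  - by rewrite subUset sub1set tF.
have sign C : (-1) ^+ #|toggle C| = - (-1) ^+ #|C| :> R.
  rewrite /toggle; case: ifPn => tC.
    by rewrite (cardsD1 (top C) C) tC exprS mulN1r opprK.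
  by rewrite cardsU1 tC exprS mulN1r.
set S := (LHS in LHS = _); suff : S = - S.
  by move=> /eqP; rewrite -addr_eq0 -mulr2n mulrn_eq0 /= => /eqP.
rewrite -{2}[S]/(\sum_(C | chain C && (C \subset F)) _) -sumrN {1}/S.
rewrite (reindex_onto toggle toggle) /=; last by move=> C _; rewrite toggleK.
apply: eq_big => [C | C _]; last exact: sign.
rewrite toggleK eqxx andbT; apply/idP/idP => [/toggleP|/toggleP//].
by rewrite toggleK.
Qed.

(* A chain is recovered from the set of its cardinalities together with, for
   each point, the least cardinality of a member containing it. *)
Lemma card_chains (T : finType) :
  (#|[set C : {set {set T}} | chain C]|
     <= #|T|.+1 ^ #|T| * 2 ^ #|T|.+1)%N.
Proof.
(* Adjoining [setT] provides a candidate even at points in no member of [C]. *)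
pose least (C : {set {set T}}) v : {set T} :=
  [arg min_(A < [set: T] | (A \in setT |: C) && (v \in A)) #|A|].
pose ord (A : {set T}) : 'I_#|T|.+1 := inord #|A|.
have ordE A : ord A = #|A| :> nat by rewrite inordK // ltnS max_card.
pose code C := ([ffun v => ord (least C v)], ord @: C).
have codeP C A : chain C -> A \in C ->
    A = [set v | (ord (least C v) <= ord A)%N].
  move=> cC AC; apply/setP => v; rewrite inE !ordE /least.
  case: arg_minnP => [|B /andP[BC vB] Bmin]; first by rewrite !inE eqxx.
  apply/idP/idP => [vA | BA]; first by apply: Bmin; rewrite vA !inE AC orbT.
  move: BC => /setU1P[BT|BC].
    have /eqP -> : A == [set: T] by rewrite eqEcard subsetT -BT.
    by rewrite inE.
  by apply: (subsetP (chain_card_le _ _ _ _ cC BC AC BA)).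
have inj : {in [set C | chain C] &, injective code}.
  have half C D : chain C -> chain D -> code C = code D -> C \subset D.
    move=> cC cD [/ffunP eqf eqo]; apply/subsetP => A AC.
    have /imsetP[B BD AB] : ord A \in ord @: D by rewrite -eqo imset_f.
    rewrite (codeP C A cC AC) AB.
    have -> : [set v | (ord (least C v) <= ord B)%N]
            = [set v | (ord (least D v) <= ord B)%N].
      by apply/setP => v; rewrite !inE; have := eqf v; rewrite !ffunE => ->.
    by rewrite -codeP.
  move=> C D /[!inE] cC cD CD; apply/eqP; rewrite eqEsubset.
  by rewrite !half.
rewrite -(card_in_imset inj); apply: (leq_trans (max_card _)).
rewrite card_prod card_ffun card_ord -[#|{set 'I_#|T|.+1}|]cardsT -powersetT.
by rewrite card_powerset cardsT card_ord.
Qed.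

(** * Hall's theorem *)

(** Induction on the size of [X]: a nonempty proper tight [S] splits the problem into [S] and its
    complement; if there is none, any [x] may take any of its neighbours. [f0] serves the empty
    [X]. *)
Lemma hall (A B : finType) (f0 : A -> B) (X : {set A}) (N : A -> {set B}) :
  (forall S : {set A}, S \subset X -> (#|S| <= #|\bigcup_(a in S) N a|)%N) ->
  exists f : A -> B,
    {in X, forall a, f a \in N a} /\ {in X &, injective f}.
Proof.
have [k] := ubnP #|X|; elim: k => [//|k IHk] in X N *; rewrite ltnS => Xk hallX.
have [->|/set0Pn[x xX]] := eqVneq X set0.
  by exists f0; split=> [a|a b]; rewrite inE.
have [[S [SX S0 tight]] | loose] : (exists S : {set A}, [/\ S \proper X, S != set0 &
    (#|\bigcup_(a in S) N a| <= #|S|)%N]) \/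
    (forall S : {set A}, S \proper X -> S != set0 -> (#|S| < #|\bigcup_(a in S) N a|)%N).
  have [/existsP[S /and3P[? ? ?]]|no] := boolP [exists S : {set A},
    [&& S \proper X, S != set0 & (#|\bigcup_(a in S) N a| <= #|S|)%N]].
    by left; exists S.
  right=> S SX S0; rewrite ltnNge; apply: contra no => h.
  by apply/existsP; exists S; rewrite SX S0.
- have SX' := proper_sub SX.
  set NS := \bigcup_(a in S) N a in tight.
  have [|U US|f [fN finj]] := IHk S N.
  + exact: leq_trans (proper_card SX) Xk.
  + by apply: hallX; apply: subset_trans US SX'.
  have [||g [gN ginj]] := IHk (X :\: S) (fun a => N a :\: NS).
  + apply: leq_trans Xk; rewrite cardsD (setIidPr SX').
    have : (0 < #|S|)%N by rewrite card_gt0.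
    by have := subset_leq_card SX'; lia.
  + move=> U UXS.
    have dUS : [disjoint U & S].
      by rewrite disjoints_subset (subset_trans UXS) // setDE subsetIr.
    (* As [S] is tight, subtracting it from the condition for [U :|: S] leaves enough neighbours of
       [U] outside [NS]. *)
    have := hallX (U :|: S); rewrite subUset SX' (subset_trans UXS (subsetDl _ _)).
    move=> /(_ isT); rewrite bigcup_setU -/NS.
    have -> : \bigcup_(a in U) (N a :\: NS) = (\bigcup_(a in U) N a) :\: NS.
      by apply/setP => b; apply/bigcupP/setDP => [[a aU /setDP[? ?]]|[/bigcupP[a aU ba] bS]];
        [split=> //; apply/bigcupP; exists a | exists a => //; apply/setDP].
    rewrite cardsU (disjoint_setI0 dUS) cards0 subn0 cardsU cardsD.
    have := subset_leq_card (subsetIl (\bigcup_(a in U) N a) NS).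
    by lia.
  exists (fun a => if a \in S then f a else g a); split=> [a aX | a b aX bX].
    case: ifPn => aS; first exact: fN.
    by have /setDP[] : g a \in N a :\: NS by apply: gN; rewrite inE aS.
  have disj c d : c \in S -> d \in X -> d \notin S -> f c != g d.
    move=> cS dX dS; have /setDP[_] : g d \in N d :\: NS by apply: gN; rewrite inE dS.
    by apply: contraNneq => <-; apply/bigcupP; exists c => //; apply: fN.
  case: ifPn => aS; case: ifPn => bS fab.
  + exact: finj.
  + by have := disj a b aS bX bS; rewrite fab eqxx.
  + by have := disj b a bS aX aS; rewrite fab eqxx.
  + by apply: ginj => //; rewrite inE ?aS ?bS.
have : (0 < #|N x|)%N.
  by have := hallX [set x]; rewrite sub1set cards1 big_set1; apply.
rewrite card_gt0 => /set0Pn[y yN].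
have [||g [gN ginj]] := IHk (X :\ x) (fun a => N a :\ y).
- by move: Xk; rewrite (cardsD1 x X) xX; lia.
- move=> U UX; have [->|U0] := eqVneq U set0; first by rewrite cards0.
  have UpX : U \proper X.
    by apply: sub_proper_trans UX _; rewrite properD1.
  (* The strict surplus pays for the loss of the single vertex [y]. *)
  have := loose U UpX U0.
  have -> : \bigcup_(a in U) (N a :\ y) = (\bigcup_(a in U) N a) :\ y.
    by apply/setP => b; apply/bigcupP/setDP => [[a aU /setDP[? ?]]|[/bigcupP[a aU ba] bS]];
      [split=> //; apply/bigcupP; exists a | exists a => //; apply/setDP].
  by rewrite (cardsD1 y (\bigcup_(a in U) N a)); lia.
exists (fun a => if a == x then y else g a); split=> [a aX | a b aX bX].
  case: eqVneq => [->//|ax].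
  by have /setD1P[] : g a \in N a :\ y by apply: gN; rewrite !inE ax.
have disj c : c \in X -> c != x -> g c != y.
  by move=> cX cx; have /setD1P[] : g c \in N c :\ y by apply: gN; rewrite !inE cx.
case: (eqVneq a x) => [->|ax]; case: (eqVneq b x) => [->|bx] // gab.
- by have := disj b bX bx; rewrite gab eqxx.
- by have := disj a aX ax; rewrite gab eqxx.
- by apply: ginj; rewrite ?inE ?ax ?bx.
Qed.

(** * Expansion of BPM over chains *)

Section HallViolators.
Variable n : nat.
Implicit Types (U : {set 'I_n + 'I_n}) (x : {ffun 'I_(n * n) -> bool}).

Definition left_part U : {set 'I_n} := [set i | inl i \in U].
Definition right_part U : {set 'I_n} := [set j | inr j \in U].

Definition deficient : {set {set 'I_n + 'I_n}} :=
  [set U | (#|right_part U| < #|left_part U|)%N].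

(* The positions of the variables x_{i,j} whose edge leaves U from the left. *)
Definition boundary U : {set 'I_(n * n)} :=
  [set mxvec_index i j | i in left_part U, j in ~: right_part U].

(** The right part only has to contain the neighbourhood of the left part; not forcing equality
    makes the closure condition stable under intersection as well as union. *)
Definition violators x : {set {set 'I_n + 'I_n}} :=
  [set U in deficient | [forall v in boundary U, ~~ x v]].

Lemma boundaryP x U :
  reflect (forall i j, inl i \in U -> x (mxvec_index i j) -> inr j \in U)
          [forall v in boundary U, ~~ x v].
Proof.
apply: (iffP forall_inP) => [h i j iU xij | h v /imset2P[i j]].
  apply: contraLR xij => jU; apply: h; apply/imset2P; exists i j; rewrite ?inE //.
rewrite !inE => iU jU ->; apply: contra jU; exact: h.
Qed.

(** Closure under edges passes to both sets. The excess of left over right vertices is modular, so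
    the two excesses have a positive sum and one of them is positive. *)
Lemma violators_latticial x :
  {in violators x &, forall A B : {set 'I_n + 'I_n},
    (A :&: B \in violators x) || (A :|: B \in violators x)}.
Proof.
move=> A B; rewrite ![_ \in violators x]inE.
move=> /andP[dA /boundaryP cA] /andP[dB /boundaryP cB].
have -> : [forall v in boundary (A :&: B), ~~ x v].
  apply/boundaryP => i j; rewrite !inE => /andP[iA iB] xij.
  by rewrite (cA i) ?(cB i).
have -> : [forall v in boundary (A :|: B), ~~ x v].
  apply/boundaryP => i j; rewrite !inE => /orP[iU|iU] xij.
    by rewrite (cA i).
  by rewrite (cB i) ?orbT.
rewrite !andbT !inE.
have -> : left_part (A :&: B) = left_part A :&: left_part B.
  by apply/setP => i; rewrite !inE.
have -> : right_part (A :&: B) = right_part A :&: right_part B.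
  by apply/setP => i; rewrite !inE.
have -> : left_part (A :|: B) = left_part A :|: left_part B.
  by apply/setP => i; rewrite !inE.
have -> : right_part (A :|: B) = right_part A :|: right_part B.
  by apply/setP => i; rewrite !inE.
move: dA dB; rewrite !inE.
have := cardsUI (left_part A) (left_part B).
have := cardsUI (right_part A) (right_part B).
by lia.
Qed.

(** A perfect matching injects the left part of a closed set into its right part. Conversely, a set
    failing Hall's condition, joined with its neighbourhood, is a violator. *)
Lemma BPM_violators x : BPM x = (violators x == set0).
Proof.
apply/existsP/eqP => [[M /and3P[/subsetP ME /forallP Ml /forallP Mr]] | none].
  have [f fM] : exists f : 'I_n -> 'I_n, forall i, (i, f i) \in M.
    apply: (@fin_all_exists _ (fun=> 'I_n) (fun i j => (i, j) \in M)) => i.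
    have /cards1P[[i' j] /setP/(_ (i', j))] := Ml i.
    by rewrite !inE eqxx => /andP[ijM /eqP <-]; exists j.
  have finj : injective f.
    move=> i i' ff; have /cards1P[e /setP eE] := Mr (f i).
    have := eE (i, f i); have := eE (i', f i').
    by rewrite !inE !fM /= -ff eqxx => /esym/eqP <- /esym/eqP[].
  apply/setP => U; rewrite !inE; apply/negP => /andP[dU /boundaryP cU].
  move: dU; rewrite ltnNge -(card_imset _ finj) subset_leq_card //.
  apply/subsetP => j /imsetP[i]; rewrite !inE => iU ->; apply: (cU i) => //.
  by have := ME _ (fM i); rewrite inE.
have [S _|f [fN finj']] :=
    @hall _ _ id [set: 'I_n] (fun i => [set j | x (mxvec_index i j)]).
  set NS := \bigcup_(a in S) _; rewrite leqNgt; apply/negP => SN.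
  pose U := [set s : 'I_n + 'I_n |
              match s with inl i => i \in S | inr j => j \in NS end].
  suff : U \in violators x by rewrite none inE.
  rewrite !inE; apply/andP; split.
    have -> : left_part U = S by apply/setP => i; rewrite !inE.
    by have -> : right_part U = NS by apply/setP => i; rewrite !inE.
  apply/boundaryP => i j; rewrite !inE => iS xij.
  by apply/bigcupP; exists i => //; rewrite inE.
have finj : injective f by move=> i j; apply: finj'; rewrite inE.
exists [set (i, f i) | i in [set: 'I_n]]; apply/and3P; split.
- by apply/subsetP => _ /imsetP[i _ ->]; rewrite inE; have := fN i; rewrite !inE; apply.
- apply/forallP => i; apply/cards1P; exists (i, f i); apply/setP => -[a b].
  rewrite !inE /=; apply/andP/eqP => [[/imsetP[c _ [-> ->]] /eqP -> //]|[-> ->]].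
  by rewrite eqxx imset_f ?inE.
- apply/forallP => j; apply/cards1P.
  have [g gK fK] := injF_bij finj.
  exists (g j, j); apply/setP => -[a b].
  rewrite !inE /=; apply/andP/eqP => [[/imsetP[c _ [-> ->]] /eqP <-]|[-> ->]].
    by rewrite gK.
  by rewrite eqxx -{2}(fK j) (imset_f (fun i => (i, f i))) ?inE.
Qed.

Definition chain_boundary (C : {set {set 'I_n + 'I_n}}) : {set 'I_(n * n)} :=
  \bigcup_(U in C) boundary U.

(** A chain of deficient sets lies in [violators x] iff all variables in the union of the boundaries
    vanish. This moves the dependence on [x] in [sum_sign_chains] from the index set to the
    summands. *)
Lemma BPM_chain_expansion (R : numDomainType) x :
  (BPM x)%:R = \sum_(C : {set {set 'I_n + 'I_n}} | chain C && (C \subset deficient))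
    (-1) ^+ #|C| * (#|[set v in chain_boundary C | x v]| == 0%N)%:R :> R.
Proof.
rewrite BPM_violators -(sum_sign_chains _ R _ (violators_latticial x)).
rewrite (eq_bigl (fun C : {set {set 'I_n + 'I_n}} => (chain C && (C \subset deficient)) &&
    (#|[set v in chain_boundary C | x v]| == 0%N))).
  rewrite big_mkcondr; apply: eq_bigr => C _.
  by case: ifP; rewrite ?mulr1 ?mulr0.
move=> C; rewrite -andbA; congr andb; rewrite cards_eq0.
apply/subsetP/andP => [CV | [/subsetP Cd /eqP/setP h0] U UC].
  split; first by apply/subsetP => U /CV; rewrite inE => /andP[].
  apply/eqP/setP => v; rewrite !inE; apply/negP => /andP[/bigcupP[U /CV UC vU]].
  by apply/negP; move: UC; rewrite inE => /andP[_ /forall_inP]; apply.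
rewrite inE Cd //; apply/forall_inP => v vU.
by have := h0 v; rewrite !inE => /negbT; rewrite negb_and (introT bigcupP) //; exists U.
Qed.

End HallViolators.

(** * Univariate polynomials in the number of true variables *)

Section CountPolynomial.
Variables (R : idomainType) (N : nat).
Implicit Types (D : {set 'I_N}) (p : {poly R}).

Definition linear_count D : mpoly.mpoly N R :=
  \sum_(v in D) mpoly.mpolyX R (mpoly.mnm1 v).

Definition count_mpoly D p : mpoly.mpoly N R :=
  \sum_(i < size p) p`_i *: linear_count D ^+ i.

Lemma meval_count_mpoly D p (x : {ffun 'I_N -> bool}) :
  mpoly.meval (fun v => (x v)%:R) (count_mpoly D p)
    = p.[#|[set v in D | x v]|%:R].
Proof.
rewrite horner_coef raddf_sum; apply: eq_bigr => i _ /=.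
rewrite mpoly.mevalZ rmorphXn /= raddf_sum /=; congr (_ * _ ^+ _).
rewrite -sum1_card natr_sum (eq_bigl (fun v => (v \in D) && x v)); last first.
  by move=> v; rewrite inE.
rewrite big_mkcondr; apply: eq_bigr => v _.
by rewrite mpoly.mevalXU; case: (x v).
Qed.

Lemma msize_count_mpoly D p : (mpoly.msize (count_mpoly D p) <= size p)%N.
Proof.
have lin : (mpoly.msize (linear_count D) <= 2)%N.
  apply: (leq_trans (mpoly.mmeasure_sum _ _ _ _)).
  by apply/bigmax_leqP => v _; rewrite mpoly.msizeX mpoly.mdeg1.
have pow i : (mpoly.msize (linear_count D ^+ i) <= i.+1)%N.
  elim: i => [|i IHi]; first by rewrite expr0 mpoly.msize1.
  (* The size formula for products requires nonzero factors, and the form is zero for empty [D]. *)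
  rewrite exprS; have [->|l0] := eqVneq (linear_count D) 0.
    by rewrite mul0r mpoly.msize0.
  rewrite mpoly.msizeM ?expf_neq0 //.
  by move: lin IHi; lia.
apply: (leq_trans (mpoly.mmeasure_sum _ _ _ _)).
apply/bigmax_leqP => i _; apply: (leq_trans (mpoly.msizeZ_le _ _)).
exact: leq_trans (pow i) (ltn_ord i).
Qed.

End CountPolynomial.

(** * The degree bound *)

(** Replacing each conjunction of the chain expansion by [p] costs at most 2^-t per chain, as the
    coefficients are signs. [card_chains] on the 2n vertices bounds the number of chains. *)
Lemma BPM_approx_degree_le (R : realType) (n t : nat) (eps : R) :
  0 <= eps ->
  ((n + n).+1 ^ (n + n) * 2 ^ (n + n).+1)%:R * 2^-1 ^+ t <= eps ->
  (approx_degree (@BPM n) eps)%:R <= 4 * Num.sqrt (n * n * t)%:R :> R.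
Proof.
move=> eps0 Weps.
have [p [pdeg p0 psmall]] := zero_indicator_degree R (n * n) t.
pose good (C : {set {set 'I_n + 'I_n}}) := chain C && (C \subset deficient n).
pose P : mpoly.mpoly (n * n) R := \sum_(C : {set {set 'I_n + 'I_n}} | good C)
  (-1) ^+ #|C| *: count_mpoly R (n * n) (chain_boundary n C) p.
have Pdeg : (total_degree P <= (size p).-1)%N.
  rewrite /total_degree -!subn1 leq_sub2r //.
  apply: (leq_trans (mpoly.mmeasure_sum _ _ _ _)).
  apply/bigmax_leqP => C _; apply: (leq_trans (mpoly.msizeZ_le _ _)).
  exact: msize_count_mpoly.
have [_ /(_ P)] := @approx_degreeP R (n * n) (@BPM n) eps eps0.
suff Papp : approximates (@BPM n) eps P.
  move=> /(_ Papp) degP; apply: le_trans pdeg.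
  by rewrite ler_nat (leq_trans degP).
move=> x; apply: le_trans Weps.
pose c (C : {set {set 'I_n + 'I_n}}) := #|[set v in chain_boundary n C | x v]|.
have -> : (BPM x)%:R - mpoly.meval (fun v => (x v)%:R) P =
    \sum_(C : {set {set 'I_n + 'I_n}} | good C)
       (-1) ^+ #|C| * ((c C == 0%N)%:R - p.[(c C)%:R]).
  under eq_bigr do rewrite mulrBr.
  rewrite sumrB (BPM_chain_expansion n R x); congr (_ - _).
  rewrite /P raddf_sum; apply: eq_bigr => C _ /=.
  by rewrite mpoly.mevalZ meval_count_mpoly.
apply: (@le_trans _ _ (\sum_(C : {set {set 'I_n + 'I_n}} | good C) 2^-1 ^+ t)).
  apply: (le_trans (ler_norm_sum _ _ _)); apply: ler_sum => C _.
  rewrite normrM normrX normrN1 expr1n mul1r.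
  have [c0|c0] := posnP (c C).
    by rewrite c0 p0 subrr normr0 exprn_ge0 // invr_ge0.
  rewrite sub0r normrN psmall // c0.
  by rewrite (leq_trans (max_card _)) ?card_ord.
rewrite sumr_const -[leLHS]mulr_natl ler_wpM2r ?exprn_ge0 ?invr_ge0 // ler_nat.
apply: leq_trans (_ : #|[set C : {set {set 'I_n + 'I_n}} | chain C]| <= _)%N.
  by apply: subset_leq_card; apply/subsetP => C; rewrite inE => /andP[].
by have := card_chains ('I_n + 'I_n)%type; rewrite card_sum card_ord.
Qed.

(** From 2n + 1 <= n^3 and 2n + 1 <= 3n, the two factors are at most n^(6n) and n^(3n). *)
Lemma chain_count_bound (n : nat) : (1 < n)%N ->
  ((n + n).+1 ^ (n + n) * 2 ^ (n + n).+1 <= n ^ (9 * n))%N.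
Proof.
move=> n1; have -> : (9 * n = 3 * (n + n) + 3 * n)%N by lia.
rewrite [leqRHS]expnD leq_mul //.
  by rewrite [leqRHS]expnM leq_exp2r ?addn_gt0 ?(ltnW n1) // !expnS expn0; nia.
rewrite (@leq_trans (2 ^ (3 * n))) // ?leq_exp2r ?muln_gt0 ?(ltnW n1) //.
by rewrite leq_exp2l //; lia.
Qed.

Theorem theorem4p6 (R : realType) :
  exists C : R, 0 < C /\
    forall (n : nat) (eps : R),
      (1 < n)%N ->
      2 `^ (- (n%:R * log2 n%:R)) <= eps -> eps <= 1 / 3 ->
      (approx_degree (@BPM n) eps)%:R
        <= C * (n%:R `^ (3 / 2) * Num.sqrt (log2 n%:R)).
Proof.
(* The choice of [t] below gives t <= 20 n log n, and 4 sqrt 20 < 20. *)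
exists 20; split=> // n eps n1 eps_lo _.
have n0 : (0 < n)%N := ltnW n1.
have n0' : 0 < n%:R :> R by rewrite ltr0n.
have ln2 : 0 < ln 2 :> R by rewrite ln_gt0 // ltr1n.
have pow2log : 2 `^ (n%:R * log2 n%:R) = n%:R ^+ n :> R.
  rewrite /powR pnatr_eq0 /= /log2 -mulrA divfK ?gt_eqF //.
  by rewrite -(lnK (x := n%:R ^+ n)) ?posrE ?exprn_gt0 // lnXn // mulr_natl.
have eps_lo' : (n ^ n)%:R^-1 <= eps by rewrite natrX -pow2log -powRN.
have eps0 : 0 <= eps by apply: le_trans eps_lo'; rewrite invr_ge0.
pose k := trunc_log 2 n.
have kn : (2 ^ k <= n)%N by rewrite trunc_logP.
have nk : (n < 2 ^ k.+1)%N by rewrite trunc_log_ltn.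
have k0 : (0 < k)%N by case: (k) nk => //; lia.
have klog : k%:R <= log2 n%:R :> R.
  rewrite /log2 ler_pdivlMr // mulr_natl -lnXn // ler_ln ?posrE ?exprn_gt0 //.
  by rewrite -natrX ler_nat.
have log0 : 0 <= log2 n%:R :> R by apply: le_trans klog.
(* The chains contribute n^(9n) and 1/eps contributes n^n; their product n^(10n) is at most 2^t
   because n < 2^(k+1). *)
pose t := (10 * n * k.+1)%N.
have Wt : (((n + n).+1 ^ (n + n) * 2 ^ (n + n).+1) * n ^ n <= 2 ^ t)%N.
  rewrite (@leq_trans (n ^ (10 * n))) //.
    have -> : (10 * n = 9 * n + n)%N by lia.
    by rewrite [leqRHS]expnD leq_mul ?chain_count_bound.
  by rewrite /t [(_ * k.+1)%N]mulnC [leqRHS]expnM leq_exp2r ?muln_gt0 // ltnW.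
have Weps : ((n + n).+1 ^ (n + n) * 2 ^ (n + n).+1)%:R * 2^-1 ^+ t <= eps.
  apply: le_trans eps_lo'; set W := (_ * _)%N in Wt *.
  rewrite exprVn -natrX ler_pdivrMr ?ltr0n ?expn_gt0 //.
  rewrite mulrC ler_pdivlMr ?ltr0n ?expn_gt0 ?n0 // -natrM ler_nat.
  exact: Wt.
apply: (le_trans (BPM_approx_degree_le _ _ _ _ eps0 Weps)).
have tlog : t%:R <= 20 * n%:R * log2 n%:R :> R.
  (* As [k] is positive, [k.+1 <= 2 * k]. *)
  rewrite (@le_trans _ _ (20 * n * k)%:R) //; first by rewrite ler_nat; nia.
  by rewrite !natrM ler_wpM2l ?mulr_ge0.
have -> : n%:R `^ (3 / 2) = n%:R * Num.sqrt n%:R :> R.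
  have -> : 3 / 2 = 1 + 2^-1 :> R by lra.
  by rewrite powRD ?powRr1 ?powR12_sqrt ?(gt_eqF n0') ?implybT.
rewrite -mulrA -sqrtrM // -(ler_pXn2r (ltn0Sn 1)) ?nnegrE ?mulr_ge0 ?sqrtr_ge0 //.
have nlog0 : 0 <= n%:R * log2 n%:R :> R by rewrite mulr_ge0.
rewrite !exprMn !sqr_sqrtr // natrM [(n * n)%:R]natrM.
have nn0 : 0 <= n%:R * n%:R :> R by rewrite mulr_ge0.
have := ler_wpM2l nn0 tlog; have := mulr_ge0 nn0 nlog0.
by rewrite [n%:R ^+ 2]expr2; lra.
Qed.
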